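(* Let $w$ be a positive radial weight on the unit disc and $\phi(r)=-\log w(r)$, $0\le r<1$. Assume $\phi:[0,1)\to\mathbb{R}$ is twice continuously differentiable and there exists $r_0\in[0,1)$ such that $\phi'(r)\ne0$ for $1>r>r_0$. Suppose $$\lim_{r\to1}\frac{e^{-\phi(r)}}{\phi'(r)}=0,\qquad\liminf_{r\to1}\frac{\phi''(r)}{\phi'(r)^2}>-1,\qquad\limsup_{r\to1}\frac{\phi''(r)}{\phi'(r)^2}<\infty .$$ Then there is $L>0$ such that $$\sup_{0<r<1}\frac{w'(r)}{w(r)^2}\int_r^1w(x)\,dx\le L,$$ and there exists $r_1\in[0,1)$ such that $$\psi_w(r)\asymp\frac1{\phi'(r)}\quad\text{for }r\in[r_1,1).$$
   Context: For a positive radial weight $w$ on the unit disc (viewed as a function on $[0,1)$), the distortion function is $\psi_w(r)=\frac1{w(r)}\int_r^1w(u)\,du$, $0\le r<1$. $E_1\asymp E_2$ means that there is a constant $k>0$ independent of the argument with $\frac1kE_1\le E_2\le kE_1$. *)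

(* Defs.v *)
From HB Require Import structures.
From mathcomp Require Import all_boot all_order all_algebra.
From mathcomp Require Import all_classical all_reals all_analysis.

Set Implicit Arguments.
Unset Strict Implicit.
Unset Printing Implicit Defensive.

Import Order.TTheory GRing.Theory Num.Theory.
Import numFieldNormedType.Exports.

Local Open Scope classical_set_scope.
Local Open Scope ring_scope.

(* A function on a set A (here always [0, 1)) is represented by a total function
   on R of which only the values on A are used.  Derivatives are therefore taken
   relative to A: at an interior point this is the usual derivative (derive1),
   and at the endpoint 0 of [0, 1) it is the right derivative. *)
Definition derivable_within (R : realType) (A : set R) (f : R -> R) (x : R) :=
  cvg ((f y - f x) / (y - x) @[y --> within A x^']).

Definition derive_within (R : realType) (A : set R) (f : R -> R) (x : R) : R :=
  lim ((f y - f x) / (y - x) @[y --> within A x^']).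

Definition twice_continuously_differentiable_on (R : realType) (A : set R)
    (f : R -> R) :=
  [/\ forall x, A x -> derivable_within A f x,
      forall x, A x -> derivable_within A (derive_within A f) x &
      {within A, continuous (derive_within A (derive_within A f))}].

(* \psi_w, with values in the extended reals so that a divergent integral is +oo. *)
Definition distortion (R : realType) (w : R -> R) (r : R) : \bar R :=
  (((w r)^-1)%:E * \int[lebesgue_measure]_(u in `[r, 1%R[) (w u)%:E)%E.

Definition asymp_on (R : realType) (A : set R) (E1 E2 : R -> \bar R) :=
  exists2 k : R, 0 < k &
    forall x, A x -> (k^-1%:E * E1 x <= E2 x)%E /\ (E2 x <= k%:E * E1 x)%E.

(* Main.v *)
(* Put [F := w / phi'].  Since [w' = - phi' w], one has
   [F' = - (1 + phi'' / phi' ^+ 2) w], so near [1] the bounds on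
   [phi'' / phi' ^+ 2] give [c w <= - F' <= C w] with [0 < c]; as [F] vanishes
   at [1], integrating over [`[r, 1[] yields [c J r <= F r <= C J r], where
   [J r] is the integral of [w] over [`[r, 1[].  In particular [phi' > 0] near
   [1], so [w' / w ^+ 2 * J = - phi' / w * J] is nonpositive there, and away
   from [1] it is bounded by compactness. *)
Require Import Defs.
From HB Require Import structures.
From mathcomp Require Import all_boot all_order all_algebra.
From mathcomp Require Import all_classical all_reals all_analysis.
From mathcomp Require Import measurable_realfun ring.

Set Implicit Arguments.
Unset Strict Implicit.
Unset Printing Implicit Defensive.

Import Order.TTheory GRing.Theory Num.Theory.
Import numFieldNormedType.Exports.

Local Open Scope classical_set_scope.
Local Open Scope ring_scope.

(** * Eventual bounds from strict bounds on upper and lower limits *)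

Lemma limf_esup_lt_near (T : choiceType) (X : filteredType T) (R : realType)
    (f : X -> \bar R) (F : set_system X) (M : \bar R) : Filter F ->
  (limf_esup f F < M)%E -> \forall x \near F, (f x < M)%E.
Proof.
move=> FF /ereal_inf_lt[_ [V FV <-] VM].
apply: filterS FV => x Vx; apply: le_lt_trans VM.
by apply: ereal_sup_ubound; exists x.
Qed.

Lemma lt_limf_einf_near (T : choiceType) (X : filteredType T) (R : realType)
    (f : X -> \bar R) (F : set_system X) (M : \bar R) : Filter F ->
  (M < limf_einf f F)%E -> \forall x \near F, (M < f x)%E.
Proof.
move=> FF; rewrite /limf_einf lteNr => /limf_esup_lt_near.
by apply: filterS => x; rewrite lteN2.
Qed.

(** * Derivatives relative to a set, and half-open intervals of integration *)

Lemma within_id (T : Type) (F : set_system T) (A : set T) :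
  Filter F -> F A -> within A F = F.
Proof.
move=> FF FA; apply/seteqP; split=> P AP; last exact: filterS AP.
have {}AP : F (fun x => A x -> P x) := AP.
by apply: filterS2 FA AP => x Ax; exact.
Qed.

(** Substitute [y = h + x]. The right-hand side is the form in which the library defines the
    derivative in direction [1], so this links [derive_within] to [derivable] and [is_derive]. *)
Lemma difference_quotient_dnbhs (R : realType) (f : R -> R) (x : R) :
  (f y - f x) / (y - x) @[y --> x^'] =
  h^-1 *: ((f \o shift x) (h *: (1 : R)) - f x) @[h --> 0^'].
Proof.
have nbhsE (Q : set R) : nbhs x Q <-> nbhs 0 (fun h => Q (h + x)).
  suff -> : nbhs x Q = nbhs 0 (fun h => Q (h + x)) by [].
  by have := near_shift 0 x Q; rewrite subr0.
rewrite predeqE => P; rewrite /fmap/= /dnbhs/= /within/=.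
split=> [/nbhsE|H].
  apply: filterS => h /= Ph h0; move: Ph; rewrite scaler1 addrK mulrC; apply.
  by rewrite -subr_eq0 addrK.
apply/nbhsE; have {}H : nbhs (0 : R) (fun h : R => h != 0 ->
  P (h^-1 *: (f (h%:A + x) - f x))) := H.
apply: filterS H => h /= Ph.
by rewrite -subr_eq0 addrK => /Ph; rewrite scaler1 mulrC.
Qed.

(** Write [f y = q y * (y - x) + f x] with [q] the difference quotient: [q] converges and [y - x]
    tends to [0]. Working relative to [A] covers the endpoint [0] of [[0, 1)] as well. *)
Lemma derivable_within_cvg (R : realType) (A : set R) (f : R -> R) (x : R) :
  derivable_within A f x -> f @ within A (nbhs x) --> f x.
Proof.
move=> fx; set q := fun y => (f y - f x) / (y - x).
have fq : q y * (y - x) + f x @[y --> within A x^'] --> f x.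
  rewrite -[X in _ --> X]add0r -(mulr0 (derive_within A f x)).
  apply: cvgD; last exact: cvg_cst.
  apply: cvgM; first exact: fx.
  rewrite -(subrr x); apply: cvgB; last exact: cvg_cst.
  apply: cvg_trans (@nbhs_dnbhs _ _); exact: cvg_within.
move=> P Px.
have {}fq : nbhs x (fun y => y != x -> A y -> P (q y * (y - x) + f x)) :=
  fq P Px.
have : nbhs x (fun y => A y -> P (f y)); last by [].
(* The punctured filter says nothing about [y = x], but there membership of [f x] in the
   neighbourhood [P] suffices. *)
apply: filterS fq => y; have [->|yx /(_ isT)] := eqVneq y x.
  by move=> _ _; exact: nbhs_singleton.
by rewrite divfK ?subr_eq0// subrK.
Qed.

(** Monotone convergence along the segments from [a] to [b - 1 / (n + 1)], which increase to the
    half-open interval. *)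
Lemma integral_itvco_le (R : realType) (f : R -> R) (a b : R) (K : \bar R) :
  a < b -> (forall x, a <= x < b -> 0 <= f x) ->
  measurable_fun [set` `[a, b[] f ->
  (forall t, a < t < b ->
    (\int[lebesgue_measure]_(x in `[a, t]) (f x)%:E <= K)%E) ->
  (\int[lebesgue_measure]_(x in `[a, b[) (f x)%:E <= K)%E.
Proof.
move=> ab f0 mf fK.
have subn n : `[a, b - n.+1%:R^-1] `<=` `[a, b[.
  move=> x /=; rewrite !in_itv/= => /andP[-> /le_lt_trans]; apply.
  by rewrite ltrBlDr ltrDl invr_gt0.
have cvI : (fun n => \int[lebesgue_measure]_(x in `[a, (b - n.+1%:R^-1)%R])
    (f x)%:E)%E @ \oo --> (\int[lebesgue_measure]_(x in `[a, b[) (f x)%:E)%E.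
  rewrite itv_bnd_open_bigcup; apply: ge0_nondecreasing_set_cvg_integral => //.
  - move=> n m nm; apply/subsetPset => x /=; rewrite !in_itv/=.
    move=> /andP[-> /le_trans]; apply.
    by rewrite lerD2l lerN2 lef_pV2 ?posrE// ler_nat.
  - by move=> n; apply/measurable_EFinP; apply: measurable_funS (subn n) mf.
  - by move=> n x /subn/=; rewrite in_itv/= lee_fin; exact: f0.
rewrite -(cvg_lim _ cvI)//; apply: lime_le.
  by apply/cvg_ex; eexists; exact: cvI.
(* The hypothesis [fK] speaks only of [t > a], so [n] is taken large enough that
   [1 / (n + 1) < b - a]. *)
have ba : 0 < b - a by rewrite subr_gt0.
apply: filterS (near_infty_natSinv_lt (PosNum ba)) => n /= nba.
by apply: fK; rewrite ltrBrDr -ltrBrDl nba ltrBlDr ltrDl invr_gt0 ltr0n.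
Qed.

(** At an interior point of [A], restricting to [A] leaves the punctured neighbourhood filter
    unchanged. *)
Lemma derivable_within_is_derive (R : realType) (A : set R) (f : R -> R)
    (x : R) : nbhs x A -> derivable_within A f x ->
  is_derive x 1 f (derive_within A f x).
Proof.
rewrite /derivable_within /derive_within => xA.
rewrite within_id; last by apply: nbhs_dnbhs.
by rewrite difference_quotient_dnbhs => fx; apply: DeriveDef.
Qed.

Lemma is_derive_derive_within (R : realType) (A : set R) (f : R -> R)
    (x l : R) : nbhs x A -> is_derive x 1 f l -> derive_within A f x = l.
Proof.
move=> xA fl; rewrite /derive_within within_id; last by apply: nbhs_dnbhs.
by rewrite difference_quotient_dnbhs; apply: derive_val.
Qed.

Lemma nbhs_itvoo (R : realType) (a b x : R) (A : set R) :
  a < x < b -> `]a, b[ `<=` A -> nbhs x A.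
Proof.
move=> xab abA; apply: filterS abA _; apply: open_nbhs_nbhs.
by split; [exact: interval_open|rewrite /= in_itv].
Qed.

(** Here [f] stands for [- F'], whose integral over the whole interval is [F a] because [F] vanishes
    at [b]. The bounds live in the extended reals since the integral of [w] could a priori be
    infinite; when [0 < c], the first one excludes this. *)
Lemma integral_itvco_comparison (R : realType) (w f F : R -> R) (a b c C : R) :
  a < b -> 0 <= c -> 0 <= C ->
  (forall x, a <= x < b -> 0 <= w x) ->
  (forall x, a <= x < b -> c * w x <= f x <= C * w x) ->
  (forall x, a <= x < b -> {for x, continuous w}) ->
  (forall x, a <= x < b -> {for x, continuous f}) ->
  (forall x, a <= x < b -> is_derive x 1 F (- f x)) ->
  F x @[x --> b^'-] --> 0 ->
  (c%:E * \int[lebesgue_measure]_(x in `[a, b[) (w x)%:E <= (F a)%:E)%E /\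
  ((F a)%:E <= C%:E * \int[lebesgue_measure]_(x in `[a, b[) (w x)%:E)%E.
Proof.
move=> ab c0 C0 w0 wfw cw cf dF F0.
have f0 x : a <= x < b -> 0 <= f x.
  by move=> xab; have /andP[+ _] := wfw _ xab; apply: le_trans;
    rewrite mulr_ge0// w0.
have meas (g : R -> R) : (forall x, a <= x < b -> {for x, continuous g}) ->
    measurable_fun [set` `[a, b[] g.
  move=> cg; apply: subspace_continuous_measurable_fun => //.
  by apply: continuous_in_subspaceT => x /[!inE]/=; rewrite in_itv; exact: cg.
have ftc s t : a <= s -> s < t < b ->
    (\int[lebesgue_measure]_(x in `[s, t]) (f x)%:E = (F s - F t)%:E)%E.
  move=> as_ /andP[st tb].
  have sub x : s <= x <= t -> a <= x < b.
    by move=> /andP[sx /le_lt_trans->//]; rewrite (le_trans as_).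
  have dNF x : s <= x <= t -> is_derive x 1 (- F) (f x).
    move=> /sub/dF dFx; rewrite -(opprK (f x)); exact: is_deriveN.
  have cNF x : s <= x <= t -> {for x, continuous (- F)}.
    move=> /dNF[/derivable1_diffP + _]; exact: differentiable_continuous.
  rewrite (@continuous_FTC2 _ f (- F) s t)//; first last.
  - move=> x; rewrite in_itv/= => /andP[/ltW sx /ltW xt].
    by rewrite derive1E; have [|_ ->] := dNF x; rewrite ?sx.
  - split.
    + move=> x; rewrite in_itv/= => /andP[/ltW sx /ltW xt].
      by have [|] := dNF x; rewrite ?sx.
    + by apply: cvg_at_right_filter; apply: cNF; rewrite lexx ltW.
    + by apply: cvg_at_left_filter; apply: cNF; rewrite lexx ltW.
  - apply: continuous_in_subspaceT => x /[!inE]/=; rewrite in_itv.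
    by move=> /sub; exact: cf.
  by rewrite -EFinB/= !fctE opprK addrC.
have Fdec s t : a <= s -> s < t < b -> F t <= F s.
  move=> as_ stb; rewrite -subr_ge0 -lee_fin -ftc//.
  apply: integral_ge0 => x /=; rewrite in_itv/= lee_fin => /andP[sx xt].
  apply: f0; rewrite (le_trans as_)//= (le_lt_trans xt)//.
  by case/andP : stb.
(* [F] is nonincreasing on the interval and tends to [0] at [b], hence stays above that limit. *)
have F_ge0 t : a <= t < b -> 0 <= F t.
  move=> /andP[at_ tb].
  have -> : 0 = lim (F x @[x --> b^'-]) by rewrite (cvg_lim _ F0).
  apply: limr_le; first by apply/cvg_ex; exists 0.
  near=> u; apply: (Fdec t u) => //.
  by apply/andP; split; near: u; [exact: nbhs_left_gt|exact: nbhs_left_lt].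
have mw := meas _ cw; have mf := meas _ cf.
have Ef (g : R -> R) : measurable_fun [set` `[a, b[] g ->
    measurable_fun [set` `[a, b[] (EFin \o g).
  by move=> ?; exact/measurable_EFinP.
(* For the upper bound, each partial integral [F a - F t] is at most [F a]; for the lower bound,
   these partial integrals tend to [F a] and never exceed the full integral. *)
have fJ : (\int[lebesgue_measure]_(x in `[a, b[) (f x)%:E = (F a)%:E)%E.
  apply/eqP; rewrite eq_le; apply/andP; split.
    apply: integral_itvco_le => // t tab.
    by rewrite ftc// lee_fin lerBlDr lerDl F_ge0//; case/andP : tab => /ltW ->.
  have FF : ((F a - F x)%:E @[x --> b^'-] --> (F a)%:E)%E.
    apply: cvg_EFin; first exact: nearW.
    by rewrite -[X in _ --> X]subr0; apply: cvgB => //; exact: cvg_cst.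
  rewrite -(cvg_lim _ FF)//; apply: lime_le.
    by apply/cvg_ex; eexists; exact: FF.
  near=> t.
  have tab : a < t < b.
    by apply/andP; split; near: t; [exact: nbhs_left_gt|exact: nbhs_left_lt].
  rewrite -ftc//; apply: ge0_subset_integral => //.
  - exact: Ef.
  - move=> x /=; rewrite !in_itv/= => /andP[->/= /le_lt_trans]; apply.
    by case/andP : tab.
have Iw : forall k : R, 0 <= k ->
    (k%:E * \int[lebesgue_measure]_(x in `[a, b[) (w x)%:E =
     \int[lebesgue_measure]_(x in `[a, b[) (k * w x)%:E)%E.
  move=> k k0; under [RHS]eq_integral do rewrite EFinM.
  by rewrite ge0_integralZl//; exact: Ef.
have mkw (k : R) : measurable_fun [set` `[a, b[] (fun x => (k * w x)%:E).
  by apply: Ef; apply: measurable_funM.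
rewrite -fJ !Iw//; split; apply: ge0_le_integral => //.
- by move=> x /=; rewrite in_itv/= lee_fin => xab; rewrite mulr_ge0// w0.
- exact: mkw.
- exact: Ef.
- by move=> x /=; rewrite in_itv/= lee_fin => /wfw/andP[].
- exact: Ef.
- exact: mkw.
- by move=> x /=; rewrite in_itv/= lee_fin => /wfw/andP[].
Unshelve. all: by end_near. Qed.

Lemma near_at_left (R : realType) (P : R -> Prop) (a b : R) : a < b ->
  (\forall x \near b^'-, P x) ->
  exists2 c : R, a < c < b & forall x, c <= x < b -> P x.
Proof.
(* The midpoint keeps the witness strictly between [a] and [b]; the radius [e / 2] instead of [e]
   lets the interval be closed on the left. *)
move=> ab /nbhs_ballP[e/= e0 bP]; exists (Num.max ((a + b) / 2) (b - e / 2)).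
  by rewrite lt_max midf_lt//= gt_max midf_lt//= ltrBlDr ltrDl divr_gt0.
move=> x /andP[]; rewrite ge_max => /andP[_ bx] xb; apply: bP => //.
rewrite /ball/= gtr0_norm ?subr_gt0// ltrBlDr -ltrBlDl (lt_le_trans _ bx)//.
by rewrite ltrD2l ltrN2 gtr_pMr// invf_lt1// ltr1n.
Qed.

Theorem lemma31 (R : realType) (w phi : R -> R)
    (w_gt0 : forall r, 0 <= r < 1 -> 0 < w r)
    (phiE : forall r, 0 <= r < 1 -> phi r = - ln (w r))
    (phi_C2 : twice_continuously_differentiable_on [set` `[0, 1[] phi) :
  let I : set R := [set` `[0, 1[] in
  let w' := derive_within I w in
  let phi' := derive_within I phi in
  let phi'' := derive_within I phi' in
  (exists r0 : R, I r0 /\ forall r, r0 < r < 1 -> phi' r != 0) ->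
  expR (- phi r) / phi' r @[r --> 1^'-] --> 0 ->
  ((-1)%:E < limf_einf (fun r => (phi'' r / phi' r ^+ 2)%:E) 1^'-)%E ->
  (limf_esup (fun r => (phi'' r / phi' r ^+ 2)%:E) 1^'- < +oo)%E ->
  (exists2 L : R, 0 < L &
     (ereal_sup [set ((w' r / w r ^+ 2)%:E *
                      \int[lebesgue_measure]_(x in `[r, 1%R[) (w x)%:E)
                | r in `]0%R, 1%R[ ] <= L%:E)%E) /\
  (exists2 r1 : R, I r1 &
     asymp_on [set` `[r1, 1[] (distortion w) (fun r => ((phi' r)^-1)%:E)).
Proof.
move=> I w' phi' phi'' [r0 [Ir0 phi'_neq0]] g0 infq supq.
case: phi_C2 => phi_d phi'_d phi''_c.

(* Regularity of [w] and [phi'] on [[0, 1)] *)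
have IP (x : R) : I x <-> 0 <= x < 1 by rewrite /I/= in_itv.
have Inbhs (x : R) : 0 < x < 1 -> nbhs x I.
  move=> x01; apply: (nbhs_itvoo x01) => y /=.
  by rewrite !in_itv/= => /andP[/ltW y0 y1]; apply/andP.
have I01 (x : R) : 0 < x < 1 -> 0 <= x < 1 by move=> /andP[/ltW-> ->].
have I_ltW (x : R) : 0 < x < 1 -> I x by move=> /I01/IP.
have wE (x : R) : 0 <= x < 1 -> w x = expR (- phi x).
  by move=> x01; rewrite phiE// opprK lnK// posrE w_gt0.
have dphi (x : R) : 0 < x < 1 -> is_derive x 1 phi (phi' x).
  move=> x01; apply: derivable_within_is_derive; first exact: Inbhs.
  exact/phi_d/I_ltW.
have dphi' (x : R) : 0 < x < 1 -> is_derive x 1 phi' (phi'' x).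
  move=> x01; apply: derivable_within_is_derive; first exact: Inbhs.
  exact/phi'_d/I_ltW.
have dw (x : R) : 0 < x < 1 -> is_derive x 1 w (- phi' x * w x).
  move=> x01; apply: (@near_eq_is_derive _ _ _ (fun y => expR (- phi y))).
    by apply: filterS (Inbhs _ x01) => y /IP/wE.
  rewrite (wE _ (I01 _ x01)) mulrC.
  have dNphi := is_deriveN (dphi _ x01).
  exact: is_derive1_comp.
have w'E (x : R) : 0 < x < 1 -> w' x = - phi' x * w x.
  by move=> x01; apply: is_derive_derive_within; [exact: Inbhs|exact: dw].
(* Continuity is needed up to the endpoint [0], so that compactness of the segment from [0] to [r1]
   can be used later. *)
have cw : {within I, continuous w}.
  apply/subspace_continuousP => x Ix.
  have := derivable_within_cvg (phi_d _ Ix) => cphi.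
  suff : w y @[y --> within I (nbhs x)] --> w x by [].
  rewrite (wE x); last exact/IP.
  have : expR (- phi y) @[y --> within I (nbhs x)] --> expR (- phi x).
    by apply: continuous_cvg; [exact: continuous_expR|exact: cvgN].
  apply: cvg_trans; apply: near_eq_cvg.
  have : nbhs x (fun y => I y -> expR (- phi y) = w y); last by [].
  by apply: (@filterE _ (nbhs x)) => y /IP/wE.
have cphi' : {within I, continuous phi'}.
  apply/subspace_continuousP => x Ix.
  exact: derivable_within_cvg (phi'_d _ Ix).
have cphi'' (x : R) : 0 < x < 1 -> {for x, continuous phi''}.
  move=> x01; have /subspace_continuousP/(_ _ (I_ltW _ x01)) := phi''_c.
  by rewrite within_id//; exact: Inbhs.

(* Constants controlling [1 + phi'' / phi' ^+ 2] near [1] *)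
have [c c0 cq] : exists2 c : R, 0 < c & \forall x \near 1^'-,
    c <= 1 + phi'' x / phi' x ^+ 2.
  have [c] : exists2 c : R, -1 < c &
      (c%:E < limf_einf (fun r => (phi'' r / phi' r ^+ 2)%:E) 1^'-)%E.
    (* A finite lower limit [l] gives the midpoint of [-1] and [l]; for [+oo] the value [0]
       serves. *)
    move: infq; case: limf_einf => [l||//].
      rewrite lte_fin => l1; exists ((-1 + l) / 2); first by rewrite midf_lt.
      by rewrite lte_fin midf_lt.
    by exists 0; rewrite ?ltry// ltrN10.
  move=> c1 /lt_limf_einf_near cq; exists (1 + c).
    by rewrite addrC -ltrBlDr sub0r.
  by apply: filterS cq => x; rewrite lte_fin lerD2l => /ltW.
have [C C0 Cq] : exists2 C : R, 0 < C & \forall x \near 1^'-,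
    1 + phi'' x / phi' x ^+ 2 <= C.
  have [M] : exists M : R,
      (limf_esup (fun r => (phi'' r / phi' r ^+ 2)%:E) 1^'- < M%:E)%E.
    move: supq; case: limf_esup => [l _|//|_].
      by exists (l + 1); rewrite lte_fin ltrDl.
    by exists 0; rewrite ltNyr.
  (* The maximum with [0] makes the constant positive even if [M] is very negative. *)
  move=> /limf_esup_lt_near Mq; exists (1 + Num.max M 0).
    by rewrite ltr_pwDl// le_max lexx orbT.
  by apply: filterS Mq => x; rewrite lte_fin lerD2l le_max => /ltW ->.
have [r1 r1I Hr1] : exists2 r1, 0 < r1 < 1 & forall x, r1 <= x < 1 ->
    phi' x != 0 /\ c <= 1 + phi'' x / phi' x ^+ 2 <= C.
  have : \forall x \near (1 : R)^'-,
      phi' x != 0 /\ c <= 1 + phi'' x / phi' x ^+ 2 <= C.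
    near=> x; split; first (apply: phi'_neq0; apply/andP; split).
    - near: x; apply: nbhs_left_gt; by move/IP : Ir0 => /andP[].
    - near: x; exact: nbhs_left_lt.
    - by apply/andP; split; near: x.
  by move=> /(near_at_left ltr01)[r1 r101 Hr1]; exists r1.

(* Comparison of [w / phi'] with the tail integral, and its consequences *)
set J := fun r => (\int[lebesgue_measure]_(x in `[r, 1%R[) (w x)%:E)%E.
have r1x_01 (x : R) : r1 <= x < 1 -> 0 < x < 1.
  by move=> /andP[r1x ->]; rewrite andbT (lt_le_trans _ r1x)//; case/andP : r1I.
have sandwich (r : R) : r1 <= r < 1 ->
    (c%:E * J r <= (w r / phi' r)%:E)%E /\ ((w r / phi' r)%:E <= C%:E * J r)%E.
  move=> /andP[r1r r1_].
  have rx x : r <= x < 1 -> r1 <= x < 1 by move=> /andP[/(le_trans r1r)-> ->].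
  apply: (@integral_itvco_comparison _ w
    (fun x => (1 + phi'' x / phi' x ^+ 2) * w x) (fun x => w x / phi' x)) => //.
  - exact: ltW.
  - exact: ltW.
  - by move=> x /rx/r1x_01/I01/w_gt0/ltW.
  - move=> x /rx/[dup]/r1x_01/I01/w_gt0 wx0 /Hr1[_ /andP[? ?]].
    by rewrite !ler_pM2r// ; apply/andP.
  - move=> x /rx/r1x_01/dw[/derivable1_diffP + _].
    exact: differentiable_continuous.
  - move=> x /rx/[dup]/Hr1[p0 _]/r1x_01 x01.
    have cw' : {for x, continuous w}.
      case: (dw _ x01) => /derivable1_diffP + _.
      exact: differentiable_continuous.
    have cp' : {for x, continuous phi'}.
      case: (dphi' _ x01) => /derivable1_diffP + _.
      exact: differentiable_continuous.
    apply: cvgM; last exact: cw'.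
    apply: cvgD; first exact: cvg_cst.
    apply: cvgM; first exact: cphi''.
    apply: cvgV; first by rewrite expf_neq0.
    by apply: cvgM; exact: cp'.
  - move=> x /rx/[dup]/Hr1[p0 _]/r1x_01 x01.
    have := is_deriveM (dw _ x01) (is_deriveV p0 (dphi' _ x01)).
    move/is_derive_eq; apply; rewrite /GRing.scale/=; field; exact: p0.
  (* The limit hypothesis is written with [expR (- phi r)], which equals [w r] on [[0, 1)]. *)
  - apply: cvg_trans g0; apply: near_eq_cvg.
    apply: filterS2 (nbhs_left_ge ltr01) (nbhs_left_lt 1) => x x0 x1.
    by rewrite wE// x0.
have w_ge0 (x : R) : I x -> (0 <= (w x)%:E)%E.
  by move=> /IP/w_gt0/ltW; rewrite lee_fin.
have J_ge0 (r : R) : 0 <= r -> (0 <= J r)%E.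
  move=> r_ge0; apply: integral_ge0 => x /=; rewrite in_itv/= => /andP[rx x1].
  by apply/w_ge0/IP; rewrite (le_trans r_ge0).
(* The lower half of [sandwich] gives [0 <= w r / phi' r]; as [w r] is positive and [phi' r]
   nonzero, the sign of [phi' r] follows. *)
have phi'_gt0 (r : R) : r1 <= r < 1 -> 0 < phi' r.
  move=> /[dup] rI /[dup]/Hr1[p0 _]/[dup]/r1x_01/[dup]/I01/w_gt0 wr0.
  move=> /andP[/ltW/J_ge0 Jr0 _] /sandwich[H _].
  have : 0 <= w r / phi' r.
    by rewrite -lee_fin (le_trans _ H)// mule_ge0// lee_fin ltW.
  by rewrite pmulr_rge0// invr_ge0 le_eqVlt eq_sym (negbTE p0).
(* An infinite [J r] would make [c%:E * J r] infinite, yet it is bounded by the real number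
   [w r / phi' r]. *)
have J_fin (r : R) : r1 <= r < 1 -> J r \is a fin_num.
  move=> rI; rewrite ge0_fin_numE; last first.
    by rewrite J_ge0//; case/andP : (r1x_01 _ rI) => /ltW.
  rewrite ltNge leye_eq; apply/eqP => Jy; have [+ _] := sandwich _ rI.
  by rewrite Jy gt0_muley// lte_fin.
have mw : measurable_fun I (EFin \o w).
  apply/measurable_EFinP; apply: subspace_continuous_measurable_fun => //.
  by rewrite /I.
have /andP[r1_gt0 r1_lt1] := r1I.
have sub01 : `[0, r1] `<=` I.
  move=> x /=; rewrite in_itv/= => /andP[x0 xr1]; apply/IP.
  by rewrite x0 (le_lt_trans xr1).
(* Split at [r1]: [w] is continuous on the compact segment from [0] to [r1], and the remaining tail
   is [J r1]. *)
have J0_fin : J 0 \is a fin_num.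
  have I_r1 : I = `[0, r1[ `|` `[r1, 1[.
    by rewrite /I (@itv_bndbnd_setU _ _ _ (BLeft r1))// bnd_simp ltW.
  rewrite ge0_fin_numE ?J_ge0// /J -/I I_r1 ge0_integral_setU//.
  - rewrite lte_add_pinfty//; last first.
      by rewrite ltey_eq J_fin// lexx.
    have fin01 : (\int[lebesgue_measure]_(x in `[0%R, r1]) (w x)%:E < +oo)%E.
      apply: integrable_lty => //; apply: continuous_compact_integrable.
        exact: segment_compact.
      exact: continuous_subspaceW cw.
    apply: le_lt_trans fin01; apply: ge0_subset_integral => //.
    + by apply: measurable_funS mw => //; rewrite /I.
    + by move=> x /sub01/w_ge0.
    + by move=> x /=; rewrite !in_itv/= => /andP[-> /ltW].
  - by rewrite -I_r1.
  - by rewrite -I_r1.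
  - apply/disj_setPS => x [] /=; rewrite !in_itv/=.
    by move=> /andP[_ xr1] /andP[]; rewrite leNgt xr1.
(* [M] is the maximum of the continuous function [- phi' / w] on the segment from [0] to [r1],
   raised to [0] if negative so that multiplying by [M] preserves inequalities. *)
have [M M0 HM] : exists2 M : R, 0 <= M &
    forall x : R, 0 < x < r1 -> - phi' x / w x <= M.
  have /(EVT_max (ltW r1_gt0))[m _ Hm] :
      {within `[0, r1], continuous (fun x => - phi' x / w x)}.
    apply: continuous_subspaceW sub01 _; apply/subspace_continuousP => x Ix.
    move/subspace_continuousP : cphi' => /(_ _ Ix) cphi'x.
    move/subspace_continuousP : cw => /(_ _ Ix) cwx.
    apply: cvgM; first exact: cvgN.
    by apply: cvgV => //; rewrite gt_eqF// w_gt0//; exact/IP.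
  exists (Num.max (- phi' m / w m) 0); first by rewrite le_max lexx orbT.
  move=> x /andP[/ltW x0 /ltW xr1]; rewrite le_max Hm// in_itv/=.
  by rewrite x0.

(* The two conclusions *)
split.
  (* The summand [1] secures strict positivity, since [M] may be [0]. *)
  exists (M * fine (J 0) + 1).
    by rewrite ltr_wpDl// mulr_ge0// fine_ge0// J_ge0.
  apply: ge_ereal_sup => _ [x /= + <-]; rewrite in_itv/= => x01.
  have wx0 := w_gt0 _ (I01 _ x01).
  have -> : w' x / w x ^+ 2 = - phi' x / w x.
    by rewrite w'E//; field; rewrite gt_eqF.
  have /andP[/ltW x0 x1] := x01.
  have J0_ge0 : 0 <= fine (J 0) by rewrite fine_ge0// J_ge0.
  (* Below [r1] the product is at most [M * J x], hence at most [M * J 0]; from [r1] on it is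
     nonpositive because [phi'] is positive there. *)
  have [xr1|r1x] := ltP x r1.
    have JxJ0 : (J x <= J 0%R)%E.
      apply: ge0_subset_integral => //.
      by move=> y /=; rewrite !in_itv/= => /andP[/(le_trans x0)-> ->].
    have Jx_fin : J x \is a fin_num.
      by rewrite ge0_fin_numE ?J_ge0// (le_lt_trans JxJ0)// ltey_eq J0_fin.
    rewrite -/(J x) -(fineK Jx_fin) -EFinM lee_fin ler_wpDr//.
    apply: (@le_trans _ _ (M * fine (J x))).
      rewrite ler_wpM2r//; first by rewrite fine_ge0// J_ge0.
      by apply: HM; case/andP : x01 => ->.
    by rewrite ler_wpM2l// fine_le.
  apply: (@le_trans _ _ 0%E); last by rewrite lee_fin addr_ge0// mulr_ge0.
  rewrite mule_le0_ge0//; last exact: J_ge0.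
  by rewrite lee_fin mulNr oppr_le0 divr_ge0// ltW// phi'_gt0// r1x.
exists r1; first exact: I_ltW.
(* Dividing [sandwich] by [w r] puts [1 / phi' r] between [c] and [C] times the distortion; this [k]
   satisfies both [k^-1 <= c] and [C <= k]. *)
have k0 : 0 < Num.max c^-1 C by rewrite lt_max C0 orbT.
exists (Num.max c^-1 C) => //.
move=> r /=; rewrite in_itv/= => rI.
have wr0 := w_gt0 _ (I01 _ (r1x_01 _ rI)).
have p0 := phi'_gt0 _ rI.
have [] := sandwich _ rI.
rewrite /distortion -/(J r) -(fineK (J_fin _ rI)).
have : 0 <= fine (J r).
  by rewrite fine_ge0// J_ge0//; case/andP : (r1x_01 _ rI) => /ltW.
move: (fine _) => j j0; rewrite -!EFinM !lee_fin => cj Cj.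
have wj0 : 0 <= (w r)^-1 * j by rewrite mulr_ge0// invr_ge0 ltW.
have wpE : (phi' r)^-1 = (w r)^-1 * (w r / phi' r) by rewrite mulKf// gt_eqF.
split.
  apply: (@le_trans _ _ (c * ((w r)^-1 * j))).
    by rewrite ler_wpM2r// invf_ple ?posrE// le_max lexx.
  by rewrite wpE mulrCA ler_pM2l// invr_gt0.
apply: (@le_trans _ _ (C * ((w r)^-1 * j))).
  by rewrite wpE [leRHS]mulrCA ler_pM2l// invr_gt0.
by rewrite ler_wpM2r// le_max lexx orbT.
Unshelve. all: by end_near. Qed.
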